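(* For $u,v,n\in\mathbb{N}$, let $C_4(u,v,n)$ be the number of partitions of $n$ into $u$ distinct parts congruent to $1$ modulo $4$ and $v$ distinct parts congruent to $3$ modulo $4$. Let $D_4(u,v,n)$ be the number of partitions $\lambda_1+\cdots+\lambda_s$ of $n$ (positive integer parts, $\lambda_1\ge\dots\ge\lambda_s$) satisfying: (1) $\lambda_i\neq 2$ for all $i$; (2) $\lambda_i-\lambda_{i+1}\ge5$ for all $1\le i<s$; (3) for all $1\le i<s$: if $\lambda_i-\lambda_{i+1}=5$ then $\lambda_i\equiv1,4\pmod 8$; if $\lambda_i-\lambda_{i+1}=6$ then $\lambda_i\equiv1,3,5,7\pmod 8$; if $\lambda_i-\lambda_{i+1}=7$ then $\lambda_i\equiv0,1,3,4,6,7\pmod 8$; if $\lambda_i-\lambda_{i+1}=8$ then $\lambda_i\equiv0,1,3,4,5,7\pmod 8$; and such that $u$ equals the number of parts congruent to $0$ or $1$ modulo $4$ plus twice the number of parts congruent to $6$ modulo $8$, and $v$ equals the number of parts congruent to $0$ or $3$ modulo $4$ plus twice the number of parts congruent to $2$ modulo $8$. Then $C_4(u,v,n)=D_4(u,v,n)$ for all $u,v,n$. *)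

(* Defs.v *)
From mathcomp Require Import all_boot.
Set Implicit Arguments. Unset Strict Implicit. Unset Printing Implicit Defensive.

Definition is_partition (n : nat) (s : seq nat) : bool :=
  [&& all (fun x => 0 < x) s, sorted geq s & sumn s == n].

(* bparts f m n : all nonincreasing sequences of positive integers,
   each part <= m, summing to n (f is fuel, f >= n suffices). *)
Fixpoint bparts (f m n : nat) : seq (seq nat) :=
  if n is 0 then [:: [::]] else
  if f is f'.+1 then
    flatten [seq [seq k :: s | s <- bparts f' k (n - k)] | k <- iota 1 (minn m n)]
  else [::].

Definition partitions (n : nat) : seq (seq nat) := bparts n n n.

Definition nparts (p : pred nat) (s : seq nat) : nat := count p s.

Definition C4_pred (u v n : nat) (s : seq nat) : bool :=
  [&& is_partition n s, uniq s,
      all (fun x => (x %% 4 == 1) || (x %% 4 == 3)) s,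
      nparts (fun x => x %% 4 == 1) s == u &
      nparts (fun x => x %% 4 == 3) s == v].

Definition C4 (u v n : nat) : nat := count (C4_pred u v n) (partitions n).

Definition D4_gap (a b : nat) : bool :=
  (b + 5 <= a) &&
  [&& (a - b == 5) ==> ((a %% 8 == 1) || (a %% 8 == 4)),
      (a - b == 6) ==> (a %% 8 \in [:: 1; 3; 5; 7]),
      (a - b == 7) ==> (a %% 8 \in [:: 0; 1; 3; 4; 6; 7]) &
      (a - b == 8) ==> (a %% 8 \in [:: 0; 1; 3; 4; 5; 7])].

Definition D4_pred (u v n : nat) (s : seq nat) : bool :=
  [&& is_partition n s,
      all (fun x => x != 2) s,
      sorted D4_gap s,
      u == nparts (fun x => (x %% 4 == 0) || (x %% 4 == 1)) s
           + 2 * nparts (fun x => x %% 8 == 6) s &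
      v == nparts (fun x => (x %% 4 == 0) || (x %% 4 == 3)) s
           + 2 * nparts (fun x => x %% 8 == 2) s].

Definition D4 (u v n : nat) : nat := count (D4_pred u v n) (partitions n).

(* Main.v *)
(* Let G_m(a,b) be the generating function, with a, b, q marking u, v, n, of the
   D4-partitions with parts at most m, and let T substitute (b q^2, a q^2) for
   (a, b). Splitting off the largest part gives a recurrence for G_m whose shape
   depends on m mod 8, and from it the finite identity
     G_(2k) = (1 + a q) T G_(2k-3)   for k >= 2,
   by induction on blocks of eight consecutive m; only one index per block is
   needed. Letting k grow, the generating function of D4 satisfies
   F(a,b) = (1 + a q) F(b q^2, a q^2), and so does the product
   prod_j (1 + a q^(4j+1)) (1 + b q^(4j+3)) that counts C4. Modulo any power of q
   this equation determines F. All series are truncated to polynomial expressions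
   over an arbitrary commutative ring, and coefficients are read off at the end in
   Z[b][a][q]. *)
Require Import Defs.
From mathcomp Require Import all_boot all_algebra.
From mathcomp Require Import zify ring.
Set Implicit Arguments. Unset Strict Implicit. Unset Printing Implicit Defensive.
Import GRing.Theory Num.Theory.

(** * Enumeration of partitions into distinct parts *)

(** The sum is left free so that one list carries all coefficients at once; splitting on the
    presence of the largest part prepares every recurrence below. *)
Fixpoint dseqs (m : nat) : seq (seq nat) :=
  if m is k.+1 then dseqs k ++ [seq k.+1 :: s | s <- dseqs k] else [:: [::]].

Lemma mem_dseqs m s :
  (s \in dseqs m) = all (fun x => 0 < x) s && path gtn m.+1 s.
Proof.
elim: m s => [|m IHm] s; first by case: s => [|[|x] s]; rewrite inE //= andbF.
rewrite mem_cat IHm; case: s => [|x s] /=; first by [].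
have -> : (x :: s \in [seq m.+1 :: t | t <- dseqs m])
          = (x == m.+1) && (s \in dseqs m).
  apply/mapP/andP => [[t tm [-> ->]]|[/eqP-> sm]]; first by rewrite eqxx tm.
  by exists s.
rewrite IHm; case: eqP => [->|neq].
  by rewrite ltnn andbF /= ltnSn.
rewrite orbF; congr (_ && (_ && _)); lia.
Qed.

Lemma uniq_dseqs m : uniq (dseqs m).
Proof.
elim: m => //= m IHm; rewrite cat_uniq IHm map_inj_uniq ?IHm; last by move=> s t [].
rewrite andbT; apply/hasPn => _ /mapP[s _ ->].
by rewrite mem_dseqs /= ltnn andbF.
Qed.

Lemma mem_bparts f m n s : n <= f ->
  (s \in bparts f m n) = [&& all (fun x => 0 < x) s, path geq m s & sumn s == n].
Proof.
elim: f m n s => [|f IHf] m [|n] s //= le_nf.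
1,2: by case: s => [|[|x] s] //=; rewrite inE /= addSn !andbF.
apply/allpairsPdep/idP => [[k [t [kin]]]|].
  rewrite mem_iota in kin; rewrite IHf; last lia.
  by case/and3P=> t0 p /eqP e -> /=; rewrite t0 p e; lia.
case: s => [|k s] //= /and3P[/andP[k0 s0] /andP[km p] /eqP e].
exists k, s; split=> //; first by rewrite mem_iota; lia.
by rewrite IHf; [rewrite s0 p; lia | lia].
Qed.

Lemma uniq_bparts f m n : uniq (bparts f m n).
Proof.
elim: f m n => [|f IHf] m [|n] //=.
apply: allpairs_uniq_dep => [|k _|]; [exact: iota_uniq | exact: IHf |].
by move=> [i s] [j t] _ _ /= [-> ->].
Qed.

Lemma path_bound (r : rel nat) m n s :
  (forall x, x <= n -> r m x) -> sumn s <= n -> sorted r s -> path r m s.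
Proof. by case: s => //= x s rm le -> ; rewrite rm //; lia. Qed.

(** Both families have distinct parts, and parts of a partition of [n] never exceed [n]; sequences
    in [dseqs n] with another sum are rejected by [p]. *)
Lemma count_partitions n (p : pred (seq nat)) :
    (forall s, p s -> is_partition n s && sorted gtn s) ->
  count p (partitions n) = count p (dseqs n).
Proof.
move=> pP; rewrite -!size_filter; apply/perm_size/uniq_perm.
- exact/filter_uniq/uniq_bparts.
- exact/filter_uniq/uniq_dseqs.
move=> s; rewrite !mem_filter; case ps: (p s) => //=.
have /andP[/and3P[s0 sg /eqP e] sG] := pP _ ps.
rewrite mem_bparts // mem_dseqs s0 e eqxx andbT /=.
rewrite (@path_bound geq n n) ?(@path_bound gtn n.+1 n) ?e //.
Qed.

(** * Shapes, weights and truncated generating functions *)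

Definition C4_shape (s : seq nat) : bool :=
  all (fun x => (x %% 4 == 1) || (x %% 4 == 3)) s.
Definition C4_u (s : seq nat) : nat := nparts (fun x => x %% 4 == 1) s.
Definition C4_v (s : seq nat) : nat := nparts (fun x => x %% 4 == 3) s.

Definition D4_shape (s : seq nat) : bool :=
  all (fun x => x != 2) s && sorted D4_gap s.
Definition D4_u (s : seq nat) : nat :=
  (nparts (fun x => (x %% 4 == 0) || (x %% 4 == 1)) s
   + 2 * nparts (fun x => x %% 8 == 6) s).
Definition D4_v (s : seq nat) : nat :=
  (nparts (fun x => (x %% 4 == 0) || (x %% 4 == 3)) s
   + 2 * nparts (fun x => x %% 8 == 2) s).

(** The constraint that a larger part placed in front imposes on the next one; it is vacuous when
    nothing follows. *)
Definition head_sat (p : pred nat) (s : seq nat) : bool :=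
  if s is x :: _ then p x else true.

Local Open Scope ring_scope.

Definition gf (V : pred (seq nat)) (u v : seq nat -> nat) (R : comNzRingType)
    (q : R) (m : nat) (a b : R) : R :=
  \sum_(s <- dseqs m | V s) a ^+ u s * b ^+ v s * q ^+ sumn s.

Lemma gf0 (V : pred (seq nat)) u v (R : comNzRingType) (q a b : R) :
  V [::] -> u [::] = 0%N -> v [::] = 0%N -> gf V u v q 0 a b = 1.
Proof.
by move=> V0 u0 v0; rewrite /gf big_mkcond big_seq1 V0 u0 v0 /= !expr0 !mulr1.
Qed.

(** * Congruences between generating functions modulo powers of [q] *)

Definition eqm (R : comNzRingType) (d x y : R) := exists c, x = y + d * c.

Section Congruence.
Variables (R : comNzRingType) (d : R).
Lemma eqm_refl x : eqm d x x.
Proof. by exists 0; rewrite mulr0 addr0. Qed.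
Lemma eqm_sym x y : eqm d x y -> eqm d y x.
Proof. by case=> c ->; exists (- c); ring. Qed.
Lemma eqm_trans x y z : eqm d x y -> eqm d y z -> eqm d x z.
Proof. by case=> c -> [e ->]; exists (e + c); ring. Qed.
Lemma eqm_mull z x y : eqm d x y -> eqm d (z * x) (z * y).
Proof. by case=> c ->; exists (z * c); ring. Qed.
End Congruence.

(** Each sequence with a part above [N] contributes a multiple of [q ^+ N.+1]. *)
Lemma eqm_gf_le V u v (R : comNzRingType) (q a b : R) N m : (N <= m)%N ->
  eqm (q ^+ N.+1) (gf V u v q m a b) (gf V u v q N a b).
Proof.
move=> /subnK <-; elim: (m - N)%N => [|k IHk]; first exact: eqm_refl.
apply: eqm_trans IHk; rewrite addSn /gf big_cat big_map /=.
exists (\sum_(s <- dseqs (k + N) | V ((k + N).+1 :: s))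
   a ^+ u ((k + N).+1 :: s) * b ^+ v ((k + N).+1 :: s) * q ^+ (k + sumn s)).
congr (_ + _); rewrite mulr_sumr; apply: eq_bigr => s _.
rewrite mulrCA -exprD; congr (_ * q ^+ _); lia.
Qed.

(** Every nonempty sequence has positive total degree in [a] and [b], so scaling both by [q ^+ N]
    makes its term divisible by [q ^+ N]. *)
Lemma eqm_gf_one (V : pred (seq nat)) u v (R : comNzRingType) (q a b : R) N m :
    V [::] -> u [::] = 0%N -> v [::] = 0%N ->
    (forall x s, V (x :: s) -> (0 < u (x :: s) + v (x :: s))%N) ->
  eqm (q ^+ N) (gf V u v q m (a * q ^+ N) (b * q ^+ N)) 1.
Proof.
move=> V0 u0 v0 uv; elim: m => [|m [c IHm]].
  rewrite gf0 //; exact: eqm_refl.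
rewrite /gf big_cat big_map /= -/(gf _ _ _ _ _ _ _) IHm.
pose w s := (u (m.+1 :: s) + v (m.+1 :: s))%N.
exists (c + \sum_(s <- dseqs m | V (m.+1 :: s)) a ^+ u (m.+1 :: s) *
   b ^+ v (m.+1 :: s) * q ^+ (N * (w s).-1) * q ^+ sumn (m.+1 :: s)).
rewrite mulrDr addrA; congr (_ + _); rewrite mulr_sumr; apply: eq_bigr => s Vs.
have e : q ^+ N * q ^+ (N * (w s).-1) = (q ^+ N) ^+ w s.
  by rewrite exprM -exprS prednK //; apply: uv.
rewrite !exprMn; transitivity (a ^+ u (m.+1 :: s) * b ^+ v (m.+1 :: s) *
  ((q ^+ N) ^+ w s) * q ^+ sumn (m.+1 :: s)).
  by rewrite [(q ^+ N) ^+ w s]exprD; ring.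
rewrite -e; ring.
Qed.

(* Iterating the functional equation multiplies [a] and [b] by arbitrarily high
   powers of [q], so modulo [q ^+ N] it has a single solution equal to 1 at a = b = 0. *)
Lemma eqm_functional_eq (R : comNzRingType) (q : R) N (F G : R -> R -> R) :
    (forall a b, eqm (q ^+ N) (F a b) ((1 + a * q) * F (b * q ^+ 2) (a * q ^+ 2))) ->
    (forall a b, eqm (q ^+ N) (G a b) ((1 + a * q) * G (b * q ^+ 2) (a * q ^+ 2))) ->
    (forall a b, eqm (q ^+ N) (F (a * q ^+ N) (b * q ^+ N)) 1) ->
    (forall a b, eqm (q ^+ N) (G (a * q ^+ N) (b * q ^+ N)) 1) ->
  forall a b, eqm (q ^+ N) (F a b) (G a b).
Proof.
move=> eF eG F1 G1.
have main i a b : (i <= N)%N ->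
    eqm (q ^+ N) (F (a * q ^+ (2 * (N - i))) (b * q ^+ (2 * (N - i))))
                 (G (a * q ^+ (2 * (N - i))) (b * q ^+ (2 * (N - i)))).
  elim: i a b => [|i IHi] a b le_iN.
    (* The exponent [2 * N] splits as [N + N], the form that [F1] and [G1] expect. *)
    rewrite subn0 mul2n -addnn exprD !mulrA.
    exact: eqm_trans (F1 _ _) (eqm_sym (G1 _ _)).
  apply: eqm_trans (eF _ _) _; apply: eqm_trans (eqm_sym (eG _ _)).
  apply: eqm_mull; have := IHi b a (ltnW le_iN).
  rewrite -!mulrA -!exprD.
  by have -> : (2 * (N - i.+1) + 2 = 2 * (N - i))%N by lia.
by move=> a b; have := main N a b (leqnn N); rewrite subnn muln0 expr0 !mulr1.
Qed.

(** * Reading off coefficients *)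

(** The outermost variable marks the sum, the middle one [u] and the innermost one [v]. *)
Lemma coef_gf V u v N i j n :
  (gf V u v ('X : {poly {poly {poly int}}}) N ('X%:P) ('X%:P%:P))`_n`_i`_j
  = (count (fun s => [&& V s, u s == i, v s == j & sumn s == n]) (dseqs N))%:R.
Proof.
rewrite /gf !coef_sum -sum1_count natr_sum big_mkcond [RHS]big_mkcond /=.
apply: eq_bigr => s _; case: (V s) => //=.
rewrite -!rmorphXn /= -polyCM coefCM coefXn mulr_natr.
rewrite [n == _]eq_sym; case: (sumn s == n); last first.
  by rewrite mulr0n !coef0 !andbF.
rewrite mulr1n coefMC coefXn mulr_natl [i == _]eq_sym; case: (u s == i); last first.
  by rewrite mulr0n !coef0.
by rewrite mulr1n coefXn eq_sym andbT; case: (v s == j).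
Qed.

(** With [q] the outermost indeterminate, a multiple of [q ^+ n.+1] has zero coefficient in degree
    [n]. *)
Lemma eqm_gf_count (V V' : pred (seq nat)) u v u' v' i j n :
    (forall (R : comNzRingType) (q a b : R),
       eqm (q ^+ n.+1) (gf V u v q n a b) (gf V' u' v' q n a b)) ->
  count (fun s => [&& V s, u s == i, v s == j & sumn s == n]) (dseqs n) =
  count (fun s => [&& V' s, u' s == i, v' s == j & sumn s == n]) (dseqs n).
Proof.
move=> /(_ {poly {poly {poly int}}} 'X 'X%:P 'X%:P%:P)[c e].
apply/eqP; rewrite -(eqr_nat int) -!coef_gf e !coefD coefXnM ltnSn.
by rewrite !coef0 addr0.
Qed.

(** * Recurrences for the D4 generating function by largest part *)

Definition C4gf := gf C4_shape C4_u C4_v.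
Definition D4gf := gf D4_shape D4_u D4_v.

Definition D4gf_head (p : pred nat) :=
  gf (fun s => D4_shape s && head_sat p s) D4_u D4_v.

Definition D4_wt (R : comNzRingType) (q a b : R) (x : nat) : R :=
  a ^+ D4_u [:: x] * b ^+ D4_v [:: x] * q ^+ x.

Lemma D4gf_head0 p (R : comNzRingType) (q a b : R) : D4gf_head p q 0 a b = 1.
Proof. exact: gf0. Qed.

Lemma D4gf0 (R : comNzRingType) (q a b : R) : D4gf q 0 a b = 1.
Proof. exact: gf0. Qed.

(** Removing a largest part [m.+1] leaves a sequence whose head respects the gap; [m != 1] rules out
    the part 2. *)
Lemma D4gf_headS p (R : comNzRingType) (q a b : R) m :
  D4gf_head p q m.+1 a b = D4gf_head p q m a b +
    ((m != 1%N) && p m.+1)%:R * D4_wt q a b m.+1 * D4gf_head (D4_gap m.+1) q m a b.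
Proof.
rewrite /D4gf_head {1}/gf /= big_cat big_map /=; congr (_ + _).
rewrite /gf mulr_sumr big_mkcond [RHS]big_mkcond; apply: eq_bigr => s _ /=.
have -> : D4_shape (m.+1 :: s) = (m != 1%N) && (D4_shape s && head_sat (D4_gap m.+1) s).
  rewrite /D4_shape /= eqSS; case: s => [|x s] /=; first by rewrite !andbT.
  by rewrite -!andbA; do !bool_congr.
case: (m != 1%N) => /=; last by rewrite !mul0r if_same.
case: (D4_shape s && _) => //=; case: (p _); last by rewrite !mul0r.
rewrite /D4_wt mul1r.
have -> : D4_u (m.+1 :: s) = (D4_u [:: m.+1] + D4_u s)%N.
  by rewrite /D4_u /nparts /=; lia.
have -> : D4_v (m.+1 :: s) = (D4_v [:: m.+1] + D4_v s)%N.
  by rewrite /D4_v /nparts /=; lia.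
rewrite !exprD; ring.
Qed.

Lemma D4gf_headT (R : comNzRingType) (q a b : R) m :
  D4gf_head xpredT q m a b = D4gf q m a b.
Proof.
rewrite /D4gf_head /D4gf /gf; apply: eq_bigl => s.
by case: s => [|x s]; rewrite [LHS]andbT.
Qed.

(** The head is the largest part, so a predicate failing above [k] bounds all parts by [k]. *)
Lemma eq_D4gf_head (p p' : pred nat) (R : comNzRingType) (q a b : R) k m :
    (k <= m)%N -> (forall i, (0 < i <= k)%N -> p i = p' i) ->
    (forall i, (k < i <= m)%N -> p i = false) ->
  D4gf_head p q m a b = D4gf_head p' q k a b.
Proof.
move=> le_km eqp p0; transitivity (D4gf_head p q k a b).
  elim: m le_km p0 => [|m IHm]; first by rewrite leqn0 => /eqP->.
  rewrite leq_eqVlt => /predU1P[->//|lt_km] p0.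
  rewrite D4gf_headS p0 ?lt_km ?leqnn // andbF !mul0r addr0 IHm // => i ikm.
  by apply: p0; lia.
elim: k eqp {le_km p0} => [|k IHk] eqp; first by rewrite !D4gf_head0.
rewrite !D4gf_headS eqp ?leqnn // IHk // => i ik; apply: eqp; lia.
Qed.

Lemma D4gfS (R : comNzRingType) (q a b : R) m : m != 1%N ->
  D4gf q m.+1 a b = D4gf q m a b +
    D4_wt q a b m.+1 * D4gf_head (D4_gap m.+1) q m a b.
Proof. by move=> m1; rewrite -!D4gf_headT D4gf_headS m1 mul1r. Qed.

Lemma D4gfS_threshold (R : comNzRingType) (q a b : R) k m :
    m != 1%N -> (k <= m)%N ->
    (forall i, (0 < i <= m)%N -> D4_gap m.+1 i = (i <= k)%N) ->
  D4gf q m.+1 a b = D4gf q m a b + D4_wt q a b m.+1 * D4gf q k a b.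
Proof.
move=> m1 km gapP; rewrite D4gfS // -[D4gf q k a b]D4gf_headT.
by rewrite (@eq_D4gf_head _ xpredT _ _ _ _ k) // => i ik; rewrite gapP; lia.
Qed.

(** [D4gf q k.+2 a b - D4gf q k.+1 a b] collects the partitions with largest part exactly [k.+2],
    the one value beyond [k] allowed below [m.+1]. *)
Lemma D4gfS_gapped (R : comNzRingType) (q a b : R) k m :
    m != 1%N -> (k.+2 <= m)%N -> k.+2 != 2 ->
    (forall i, (0 < i <= m)%N -> D4_gap m.+1 i = (i <= k)%N || (i == k.+2)) ->
  D4gf q m.+1 a b = D4gf q m a b +
    D4_wt q a b m.+1 * (D4gf q k a b + (D4gf q k.+2 a b - D4gf q k.+1 a b)).
Proof.
move=> m1 km k0 gapP; rewrite D4gfS // (@D4gfS _ _ _ _ k.+1) //.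
rewrite (@eq_D4gf_head _ (D4_gap m.+1) _ _ _ _ k.+2) //; last first.
  by move=> i ik; rewrite gapP; lia.
rewrite D4gf_headS gapP ?km // eqxx orbT -[D4gf q k a b]D4gf_headT.
rewrite (@eq_D4gf_head _ xpredT _ _ _ _ k k.+1) //; first last.
- by move=> i ik; rewrite gapP; lia.
- by move=> i ik; rewrite gapP; lia.
have -> : (k.+1 != 1%N) && true by lia.
congr (_ + _ * (_ + _)); rewrite mul1r; ring.
Qed.

(* [c] stands for [G 0]. In the last three steps of a block the parts allowed
   below the largest one are those up to [5 + 8 * j] and the isolated [7 + 8 * j],
   whence the difference [G (7 + 8 * j) - G (6 + 8 * j)]. *)
Record D4_rec (R : comNzRingType) (q a b c : R) (G : nat -> R) : Prop := {
  D4_rec1 : G 1%N = c + a * q * c;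
  D4_rec2 : G 2 = G 1%N;
  D4_rec3 : G 3 = G 2 + b * q ^+ 3 * c;
  D4_rec4 : G 4 = G 3 + a * b * q ^+ 4 * c;
  D4_rec5 : G 5 = G 4 + a * q ^+ 5 * c;
  D4_rec6 : G 6 = G 5 + a ^+ 2 * q ^+ 6 * c;
  D4_rec7 j : G (7 + 8 * j)%N =
    G (6 + 8 * j)%N + b * q ^+ 7 * q ^+ (8 * j) * G (1 + 8 * j)%N;
  D4_rec8 j : G (8 + 8 * j)%N =
    G (7 + 8 * j)%N + a * b * q ^+ 8 * q ^+ (8 * j) * G (1 + 8 * j)%N;
  D4_rec9 j : G (9 + 8 * j)%N =
    G (8 + 8 * j)%N + a * q ^+ 9 * q ^+ (8 * j) * G (4 + 8 * j)%N;
  D4_rec10 j : G (10 + 8 * j)%N =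
    G (9 + 8 * j)%N + b ^+ 2 * q ^+ 10 * q ^+ (8 * j) * G (1 + 8 * j)%N;
  D4_rec11 j : G (11 + 8 * j)%N =
    G (10 + 8 * j)%N + b * q ^+ 11 * q ^+ (8 * j) * G (5 + 8 * j)%N;
  D4_rec12 j : G (12 + 8 * j)%N = G (11 + 8 * j)%N + a * b * q ^+ 12 * q ^+ (8 * j) *
    (G (5 + 8 * j)%N + (G (7 + 8 * j)%N - G (6 + 8 * j)%N));
  D4_rec13 j : G (13 + 8 * j)%N = G (12 + 8 * j)%N + a * q ^+ 13 * q ^+ (8 * j) *
    (G (5 + 8 * j)%N + (G (7 + 8 * j)%N - G (6 + 8 * j)%N));
  D4_rec14 j : G (14 + 8 * j)%N = G (13 + 8 * j)%N + a ^+ 2 * q ^+ 14 * q ^+ (8 * j) *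
    (G (5 + 8 * j)%N + (G (7 + 8 * j)%N - G (6 + 8 * j)%N))
}.

(** Both weights of a part depend only on its residue modulo 8, so a shift by [8 * j] affects only
    the power of [q]. *)
Lemma D4_wtE (R : comNzRingType) (q a b : R) r j :
  D4_wt q a b (r + 8 * j) = a ^+ D4_u [:: r] * b ^+ D4_v [:: r] * q ^+ r * q ^+ (8 * j).
Proof.
have -> : D4_wt q a b (r + 8 * j) =
    a ^+ D4_u [:: r] * b ^+ D4_v [:: r] * q ^+ (r + 8 * j).
  have m8 : ((r + 8 * j) %% 8 = r %% 8)%N by rewrite mulnC addnC modnMDl.
  have m4 : ((r + 8 * j) %% 4 = r %% 4)%N.
    have -> : (r + 8 * j = (j * 2) * 4 + r)%N by lia.
    exact: modnMDl.
  by rewrite /D4_wt /D4_u /D4_v /nparts /= m8 m4.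
by rewrite exprD !mulrA.
Qed.

Lemma D4gf_rec (R : comNzRingType) (q a b : R) :
  D4_rec q a b 1 (fun m => D4gf q m a b).
Proof.
have thr r k j : (k <= r)%N -> (r + 8 * j != 1)%N ->
    (forall i, (0 < i <= r + 8 * j)%N -> D4_gap (r.+1 + 8 * j) i = (i <= k + 8 * j)%N) ->
    D4gf q (r.+1 + 8 * j) a b = D4gf q (r + 8 * j) a b +
      a ^+ D4_u [:: r.+1] * b ^+ D4_v [:: r.+1] * q ^+ r.+1 * q ^+ (8 * j) *
      D4gf q (k + 8 * j) a b.
  move=> kr r1 gapP; rewrite -D4_wtE.
  by apply: (@D4gfS_threshold _ _ _ _ _ (r + 8 * j)) => //; rewrite leq_add2r.
have gap3 r j : (10 < r)%N ->
    (forall i, (0 < i <= r + 8 * j)%N ->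
       D4_gap (r.+1 + 8 * j) i = (i <= 5 + 8 * j)%N || (i == 7 + 8 * j)%N) ->
    D4gf q (r.+1 + 8 * j) a b = D4gf q (r + 8 * j) a b +
      a ^+ D4_u [:: r.+1] * b ^+ D4_v [:: r.+1] * q ^+ r.+1 * q ^+ (8 * j) *
      (D4gf q (5 + 8 * j) a b + (D4gf q (7 + 8 * j) a b - D4gf q (6 + 8 * j) a b)).
  move=> r10 gapP; rewrite -D4_wtE.
  by apply: (@D4gfS_gapped _ _ _ _ (5 + 8 * j) (r + 8 * j)) => //; lia.
(* Parts up to 6 stand alone: a gap of at least 5 leaves only 1 below 6, and 6 is neither 1 nor 4
   modulo 8. *)
have thr0 r : (r != 1)%N -> (forall i, (0 < i <= r)%N -> D4_gap r.+1 i = false) ->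
    D4gf q r.+1 a b = D4gf q r a b +
      a ^+ D4_u [:: r.+1] * b ^+ D4_v [:: r.+1] * q ^+ r.+1 * 1.
  move=> r1 gapP; have := thr r 0%N 0%N; rewrite muln0 !addn0 D4gf0 expr0 !mulr1.
  by apply => // i ir; rewrite gapP //; lia.
split=> [||||||j|j|j|j|j|j|j|j].
- by rewrite thr0 //; [rewrite D4gf0 /=; ring | case].
- by rewrite -D4gf_headT D4gf_headS mulr0n !mul0r addr0 D4gf_headT.
- by rewrite thr0; [rewrite /=; ring | | by do 3 case=> //].
- by rewrite thr0; [rewrite /=; ring | | by do 4 case=> //].
- by rewrite thr0; [rewrite /=; ring | | by do 5 case=> //].
- by rewrite thr0; [rewrite /=; ring | | by do 6 case=> //].
- by rewrite (thr _ 1%N); [rewrite /=; ring | | lia | move=> i; rewrite /D4_gap !inE; lia].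
- by rewrite (thr _ 1%N); [rewrite /=; ring | | lia | move=> i; rewrite /D4_gap !inE; lia].
- by rewrite (thr _ 4); [rewrite /=; ring | | lia | move=> i; rewrite /D4_gap !inE; lia].
- by rewrite (thr _ 1%N); [rewrite /=; ring | | lia | move=> i; rewrite /D4_gap !inE; lia].
- by rewrite (thr _ 5); [rewrite /=; ring | | lia | move=> i; rewrite /D4_gap !inE; lia].
all: by rewrite gap3; [rewrite /=; ring | | move=> i; rewrite /D4_gap !inE; lia].
Qed.

(** * The finite identity for D4 and its functional equation *)

(** The rules are jointly linear in [G] and [c], so the factor [1 + a * q] can be absorbed into the
    initial value. *)
Lemma D4_rec_scale (R : comNzRingType) (q a b c d : R) G :
  D4_rec q a b c G -> D4_rec q a b (d * c) (fun m => d * G m).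
Proof.
case=> r1 r2 r3 r4 r5 r6 r7 r8 r9 r10 r11 r12 r13 r14.
split=> [||||||j|j|j|j|j|j|j|j].
- by rewrite r1; ring.
- by rewrite r2.
- by rewrite r3; ring.
- by rewrite r4; ring.
- by rewrite r5; ring.
- by rewrite r6; ring.
- by rewrite r7; ring.
- by rewrite r8; ring.
- by rewrite r9; ring.
- by rewrite r10; ring.
- by rewrite r11; ring.
- by rewrite r12; ring.
- by rewrite r13; ring.
- by rewrite r14; ring.
Qed.

Lemma D4_rec_shift (R : comNzRingType) (q a b : R) (G H : nat -> R) :
    D4_rec q a b 1 G -> D4_rec q (b * q ^+ 2) (a * q ^+ 2) (1 + a * q) H ->
  forall j, H (1 + 8 * j)%N = G (4 + 8 * j)%N.
Proof.
move=> rG rH.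
(* Besides the identity at three indices, the induction carries [H (4 + 8 * j)], which the rule for
   [H (9 + 8 * j)] calls for, and a common factor [x] of the increments of [G] at [5 + 8 * j] and
   [6 + 8 * j]. *)
have main j : let Q := q ^+ (8 * j) in
  [/\ H (1 + 8 * j)%N = G (4 + 8 * j)%N, H (5 + 8 * j)%N = G (8 + 8 * j)%N,
      H (7 + 8 * j)%N = G (10 + 8 * j)%N,
      H (4 + 8 * j)%N = G (6 + 8 * j)%N + a * b * q ^+ 8 * Q * G (1 + 8 * j)%N &
      exists x, G (5 + 8 * j)%N = G (4 + 8 * j)%N + a * q ^+ 5 * Q * x /\
        G (6 + 8 * j)%N = G (5 + 8 * j)%N + a ^+ 2 * q ^+ 6 * Q * x].
  elim: j => [|j [h1 h5 h7 h4 [x [g5 g6]]]] Q.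
    rewrite {}/Q.
    have := D4_rec7 rG 0; have := D4_rec8 rG 0; have := D4_rec9 rG 0.
    have := D4_rec10 rG 0; have := D4_rec7 rH 0.
    rewrite muln0 !addn0 expr0 !mulr1 => h7 g10 g9 g8 g7.
    split; last first.
      exists 1; split; [rewrite (D4_rec5 rG) | rewrite (D4_rec6 rG)]; by rewrite !mulr1.
    + rewrite (D4_rec6 rG) (D4_rec5 rG) (D4_rec4 rG) (D4_rec3 rG) (D4_rec2 rG).
      rewrite (D4_rec1 rG) (D4_rec4 rH) (D4_rec3 rH) (D4_rec2 rH).
      rewrite (D4_rec1 rH); ring.
    + rewrite g10 g9 g8 g7 (D4_rec6 rG) (D4_rec5 rG) (D4_rec4 rG) (D4_rec3 rG).
      rewrite (D4_rec2 rG) (D4_rec1 rG) h7 (D4_rec6 rH) (D4_rec5 rH) (D4_rec4 rH).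
      rewrite (D4_rec3 rH) (D4_rec2 rH) (D4_rec1 rH); ring.
    + rewrite g8 g7 (D4_rec6 rG) (D4_rec5 rG) (D4_rec4 rG) (D4_rec3 rG) (D4_rec2 rG).
      rewrite (D4_rec1 rG) (D4_rec5 rH) (D4_rec4 rH) (D4_rec3 rH) (D4_rec2 rH).
      rewrite (D4_rec1 rH); ring.
    + rewrite (D4_rec1 rH) (D4_rec4 rG) (D4_rec3 rG) (D4_rec2 rG) (D4_rec1 rG); ring.
  have g15 : G (15 + 8 * j)%N = G (14 + 8 * j)%N + b * q ^+ 7 * Q * G (9 + 8 * j)%N.
    by have := D4_rec7 rG j.+1; rewrite -/Q mulnS.
  have g16 : G (16 + 8 * j)%N = G (15 + 8 * j)%N + a * b * q ^+ 8 * Q * G (9 + 8 * j)%N.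
    by have := D4_rec8 rG j.+1; rewrite -/Q mulnS.
  have g17 : G (17 + 8 * j)%N = G (16 + 8 * j)%N + a * q ^+ 9 * Q * G (12 + 8 * j)%N.
    by have := D4_rec9 rG j.+1; rewrite -/Q mulnS.
  have g18 : G (18 + 8 * j)%N =
      G (17 + 8 * j)%N + b ^+ 2 * q ^+ 10 * Q * G (9 + 8 * j)%N.
    by have := D4_rec10 rG j.+1; rewrite -/Q mulnS.
  have h15 : H (15 + 8 * j)%N =
      H (14 + 8 * j)%N + a * q ^+ 2 * q ^+ 7 * Q * H (9 + 8 * j)%N.
    by have := D4_rec7 rH j.+1; rewrite -/Q mulnS.
  (* No induction hypothesis covers [H (6 + 8 * j)], so the rule for [H (7 + 8 * j)] is solved for
     it. *)
  have h6 : H (6 + 8 * j)%N =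
      H (7 + 8 * j)%N - a * q ^+ 2 * q ^+ 7 * q ^+ (8 * j) * H (1 + 8 * j)%N.
    by rewrite (D4_rec7 rH j) addrK.
  have QE : Q = q ^+ 8 * q ^+ (8 * j) by rewrite /Q mulnS exprD.
  (* The common factor in the rules for 13 and 14, hence the next [x]; in the first block it was 1,
     since 5 and 6 stand alone. *)
  pose X := G (5 + 8 * j)%N + (G (7 + 8 * j)%N - G (6 + 8 * j)%N).
  rewrite mulnS; split; last first.
    exists X; split.
      by rewrite [LHS](D4_rec13 rG j) QE /X; congr (_ + _); ring.
    by rewrite [LHS](D4_rec14 rG j) QE /X; congr (_ + _); ring.
  1: change (H (12 + 8 * j)%N =
       G (14 + 8 * j)%N + a * b * q ^+ 8 * Q * G (9 + 8 * j)%N).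
  2: change (H (15 + 8 * j)%N = G (18 + 8 * j)%N).
  3: change (H (13 + 8 * j)%N = G (16 + 8 * j)%N).
  4: change (H (9 + 8 * j)%N = G (12 + 8 * j)%N).
  (* Both sides are reduced to [G (1 + 8 * j)], [G (4 + 8 * j)], [x] and [q ^+ (8 * j)], leaving a
     polynomial identity. *)
  1-4: rewrite ?h15 ?g18 ?g17 ?g16 ?g15 ?QE ?(D4_rec14 rG) ?(D4_rec13 rG) ?(D4_rec12 rG).
  1-4: rewrite ?(D4_rec11 rG) ?(D4_rec14 rH) ?(D4_rec13 rH) ?(D4_rec12 rH).
  1-4: rewrite ?(D4_rec11 rH) ?(D4_rec10 rH) ?(D4_rec9 rH) ?(D4_rec8 rH).
  1-4: rewrite ?h6 ?h7 ?h5 ?h4 ?h1.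
  1-4: rewrite ?(D4_rec10 rG) ?(D4_rec9 rG) ?(D4_rec8 rG) ?(D4_rec7 rG) ?g6 ?g5.
  1-4: move: (q ^+ (8 * j)) => Q'; ring.
by move=> j; case: (main j).
Qed.

Lemma D4gf_functional_eq (R : comNzRingType) (q a b : R) N :
  eqm (q ^+ N.+1) (D4gf q N a b)
      ((1 + a * q) * D4gf q N (b * q ^+ 2) (a * q ^+ 2)).
Proof.
(* Taking [j = N] puts both indices of the exact identity beyond [N], where truncations agree modulo
   [q ^+ N.+1]. *)
have e : D4gf q (4 + 8 * N) a b =
    (1 + a * q) * D4gf q (1 + 8 * N) (b * q ^+ 2) (a * q ^+ 2).
  have := D4_rec_scale (1 + a * q) (D4gf_rec q (b * q ^+ 2) (a * q ^+ 2)).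
  by rewrite mulr1 => rH; rewrite -(D4_rec_shift (D4gf_rec q a b) rH).
apply: (@eqm_trans _ _ _ (D4gf q (4 + 8 * N) a b)).
  by apply/eqm_sym/eqm_gf_le; lia.
by rewrite e; apply/eqm_mull/eqm_gf_le; lia.
Qed.

(** * The C4 product and its functional equation *)

(** No condition links distinct parts, so each admissible part contributes an independent factor;
    even numbers contribute 1. *)
Lemma C4gfS (R : comNzRingType) (q a b : R) m :
  C4gf q m.+1 a b = C4gf q m a b * (1 +
    (if (m.+1 %% 4)%N == 1%N then a else if (m.+1 %% 4)%N == 3 then b else 0)
    * q ^+ m.+1).
Proof.
rewrite mulrDr mulr1 /C4gf {1}/gf big_cat big_map /=; congr (_ + _).
rewrite /gf mulr_suml big_mkcond [RHS]big_mkcond; apply: eq_bigr => s _ /=.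
rewrite -/(C4_shape s).
rewrite /C4_u /C4_v /nparts /= !exprD; case: (C4_shape s); rewrite ?andbF //.
have [e|_] /= := eqVneq (m.+1 %% 4)%N 1%N; first by rewrite e /= expr0 expr1; ring.
by have [_|_] /= := eqVneq (m.+1 %% 4)%N 3; rewrite ?expr0 ?expr1; ring.
Qed.

(** The substitution sends each factor of the product to the next one, so only [1 + a * q] is
    missing. The two truncations alternate, each feeding the other. *)
Lemma C4gf_shift (R : comNzRingType) (q : R) j :
  (forall a b, C4gf q (3 + 4 * j) a b =
     (1 + a * q) * C4gf q (1 + 4 * j) (b * q ^+ 2) (a * q ^+ 2)) /\
  (forall a b, C4gf q (5 + 4 * j) a b =
     (1 + a * q) * C4gf q (3 + 4 * j) (b * q ^+ 2) (a * q ^+ 2)).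
Proof.
have res r k : ((r + 4 * k) %% 4 = r %% 4)%N by rewrite mulnC addnC modnMDl.
have step3 k a b : C4gf q (3 + 4 * k) a b =
    C4gf q (1 + 4 * k) a b * (1 + b * q ^+ 3 * q ^+ (4 * k)).
  by rewrite 2!C4gfS (res 2 k) (res 3 k) /= mul0r addr0 mulr1 (exprD _ 3) mulrA.
have step5 k a b : C4gf q (5 + 4 * k) a b =
    C4gf q (3 + 4 * k) a b * (1 + a * q ^+ 5 * q ^+ (4 * k)).
  by rewrite 2!C4gfS (res 4 k) (res 5 k) /= mul0r addr0 mulr1 (exprD _ 5) mulrA.
have step53 k a b : (forall a b, C4gf q (3 + 4 * k) a b =
     (1 + a * q) * C4gf q (1 + 4 * k) (b * q ^+ 2) (a * q ^+ 2)) ->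
   C4gf q (5 + 4 * k) a b =
     (1 + a * q) * C4gf q (3 + 4 * k) (b * q ^+ 2) (a * q ^+ 2).
  by move=> e; rewrite step5 e step3; ring.
elim: j => [|j [_ IH5]].
  have e3 a b : C4gf q (3 + 4 * 0) a b =
      (1 + a * q) * C4gf q (1 + 4 * 0) (b * q ^+ 2) (a * q ^+ 2).
    rewrite step3 muln0 addn0 !C4gfS /C4gf !gf0 //= expr0; ring.
  by split=> // a b; apply: step53.
have e3 a b : C4gf q (3 + 4 * j.+1) a b =
    (1 + a * q) * C4gf q (1 + 4 * j.+1) (b * q ^+ 2) (a * q ^+ 2).
  rewrite step3 mulnS; change (1 + (4 + 4 * j))%N with (5 + 4 * j)%N.
  rewrite IH5 [X in _ = _ * X]step5 (exprD _ 4); ring.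
by split=> // a b; apply: step53.
Qed.

Lemma C4gf_functional_eq (R : comNzRingType) (q a b : R) N :
  eqm (q ^+ N.+1) (C4gf q N a b)
      ((1 + a * q) * C4gf q N (b * q ^+ 2) (a * q ^+ 2)).
Proof.
apply: (@eqm_trans _ _ _ (C4gf q (3 + 4 * N) a b)).
  by apply/eqm_sym/eqm_gf_le; lia.
by rewrite (proj1 (C4gf_shift q N)); apply/eqm_mull/eqm_gf_le; lia.
Qed.

(** * Comparison of the two counts *)

Lemma eqm_C4gf_D4gf (R : comNzRingType) (q a b : R) N :
  eqm (q ^+ N.+1) (C4gf q N a b) (D4gf q N a b).
Proof.
move: a b; apply: eqm_functional_eq => a b.
- exact: C4gf_functional_eq.
- exact: D4gf_functional_eq.
- apply: eqm_gf_one => // x s; rewrite /C4_shape /C4_u /C4_v /nparts /=; lia.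
(* Parts congruent to 2 or 6 modulo 8 count twice in one statistic, so every part has positive
   degree. *)
- apply: eqm_gf_one => // x s _; rewrite /D4_u /D4_v /nparts /=; lia.
Qed.

Theorem theorem2p3 (u v n : nat) : C4 u v n = D4 u v n.
Proof.
rewrite /C4 /D4 !count_partitions.
- transitivity (count (fun s => [&& C4_shape s, C4_u s == u, C4_v s == v & sumn s == n])
                      (dseqs n)).
    apply: eq_in_count => s; rewrite mem_dseqs => /andP[s0 ps].
    rewrite /C4_pred /is_partition s0 (sub_sorted _ (path_sorted ps)); last first.
      by move=> x y /ltnW.
    rewrite (sorted_uniq _ _ (path_sorted ps)); last 2 first.
    + by move=> x y z /= xy yz; lia.
    + by move=> x; rewrite /= ltnn.
    by rewrite /C4_shape /C4_u /C4_v /=; case: (sumn s == n); rewrite ?andbF ?andbT.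
  rewrite (@eqm_gf_count C4_shape D4_shape C4_u C4_v D4_u D4_v); last first.
    by move=> R q a b; apply: eqm_C4gf_D4gf.
  apply: eq_in_count => s; rewrite mem_dseqs => /andP[s0 ps].
  rewrite /D4_pred /is_partition s0 (sub_sorted _ (path_sorted ps)); last first.
    by move=> x y /ltnW.
  rewrite /D4_shape -/(D4_u s) -/(D4_v s) ![_ == D4_u s]eq_sym ![_ == D4_v s]eq_sym.
  by case: (sumn s == n); rewrite ?andbF ?andbT //= -andbA.
- move=> s /and3P[-> _ /and3P[gs _ _]] /=; apply: sub_sorted gs => x y.
  by rewrite /D4_gap => /andP[/= ? _]; lia.
- move=> s /and3P[sp us _]; rewrite sp /=; case/and3P: sp => _ sg _.
  by rewrite gtn_sorted_uniq_geq us.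
Qed.
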